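(* Let $F=(V,E\cup A)$ be a finite mixed graph and let $h$ be an integer-valued intersecting supermodular set function on the subsets of $V$. There exists an orientation $\vec E$ of $E$ such that $$d^-_{\vec E\cup A}(X)\ \ge\ h(X)-h(P_F^X)\qquad\text{for every } X\subseteq V$$ if and only if the following holds: for every strongly connected component $C$ of $F$ and every family $\mathcal P$ of subsets of $P_F^C$ such that $Z\cap C\neq\emptyset$ and $e_{E\cup A}(Z-C)=0$ for every $Z\in\mathcal P$, and $Z\cap Z'\cap C=\emptyset$ for all distinct $Z,Z'\in\mathcal P$, we have $$e_{E\cup A}(\mathcal P)\ \ge\ \sum_{Z\in\mathcal P}\bigl(h(Z)-h(P_F^C)\bigr).$$
   Context: A mixed graph $F=(V,E\cup A)$ has a set $E$ of (undirected) edges and a set $A$ of arcs; parallel elements are allowed. An orientation $\vec E$ of $E$ replaces each edge $uv$ by one of the arcs $uv$ or $vu$. For a set of arcs $B$ and $X\subseteq V$, $d^-_B(X)$ is the number of arcs of $B$ entering $X$ (tail outside $X$, head in $X$). A mixed path is a subgraph whose edges can be oriented so that it becomes a directed path (a single vertex is a trivial path). For $X\subseteq V$, $P_F^X$ is the set of vertices from which there is a mixed path to at least one vertex of $X$ (so $X\subseteq P_F^X$). $F$ is strongly connected if there is a mixed path from $s$ to $t$ for all $s,t\in V$; the strongly connected components are the maximal strongly connected subgraphs (their vertex sets are identified with the subgraphs). An edge enters $Y\subseteq V$ if exactly one of its ends lies in $Y$; an arc enters $Y$ if its head is in $Y$ and its tail is not. For a family $\mathcal P$ of subsets of $V$, $e_{E\cup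 A}(\mathcal P)$ is the number of elements of $E\cup A$ that enter some member of $\mathcal P$, and $e_{E\cup A}(X)=e_{E\cup A}(\{X\})$. A set function $h$ is intersecting supermodular if $h(X)+h(Y)\le h(X\cap Y)+h(X\cup Y)$ whenever $X\cap Y\neq\emptyset$. *)

(* Defs.v *)
From mathcomp Require Import all_boot all_order all_algebra.

Set Implicit Arguments.
Unset Strict Implicit.
Unset Printing Implicit Defensive.

Import Order.TTheory GRing.Theory Num.Theory.

(* Edges and arcs are indexed by finite types, so parallel elements are allowed.
   [ends e] lists the two ends of the undirected edge [e] in an arbitrary order:
   every notion below is invariant under swapping them.  [dir a] is
   (tail, head).  Loops are not excluded; they enter no set. *)
Record mixed_graph (V : finType) := MixedGraph {
  edge : finType;
  arc : finType;
  ends : edge -> V * V;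
  dir : arc -> V * V
}.

Section MixedGraph.

Variables (V : finType) (F : mixed_graph V).

Definition swap_ends (p : V * V) : V * V := (p.2, p.1).

Definition is_orientation (o : edge F -> V * V) : Prop :=
  forall e, o e = ends e \/ o e = swap_ends (ends e).

Definition oriented (o : edge F -> V * V) (x : edge F + arc F) : V * V :=
  match x with inl e => o e | inr a => dir a end.

Definition arc_enters (p : V * V) (X : {set V}) : bool :=
  (p.1 \notin X) && (p.2 \in X).

Definition indeg (B : finType) (b : B -> V * V) (X : {set V}) : nat :=
  #|[set x : B | arc_enters (b x) X]|.

Definition enters (x : edge F + arc F) (Y : {set V}) : bool :=
  match x with
  | inl e => ((ends e).1 \in Y) (+) ((ends e).2 \in Y)
  | inr a => arc_enters (dir a) Y
  end.

Definition e_fam (P : {set {set V}}) : nat :=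
  #|[set x : edge F + arc F | [exists Y in P, enters x Y]]|.

Definition e_set (X : {set V}) : nat := e_fam [set X].

Definition mstep : rel V := fun u v =>
  [exists e : edge F, (ends e == (u, v)) || (ends e == (v, u))]
  || [exists a : arc F, dir a == (u, v)].

(* [s :: p] is the vertex sequence of a mixed path. *)
Definition mixed_path (s : V) (p : seq V) : bool :=
  path mstep s p && uniq (s :: p).

Definition mreach : rel V := connect mstep.

Lemma mreachP (s t : V) :
  reflect (exists2 p, mixed_path s p & t = last s p) (mreach s t).
Proof.
apply: (iffP connectP) => [[p sp ->]|[p /andP[sp _] ->]]; last by exists p.
by case: (shortenP sp) => q sq uq _; exists q => //; rewrite /mixed_path sq uq.
Qed.

Definition Pset (X : {set V}) : {set V} :=
  [set v | [exists x in X, mreach v x]].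

(* Strong connectivity of the subgraph induced by [C]. *)
Definition strongly_connected (C : {set V}) : bool :=
  (C != set0) &&
  [forall s in C, forall t in C,
     connect [rel u v | [&& u \in C, v \in C & mstep u v]] s t].

(* A maximal strongly connected subgraph is induced, so maximality may be
   taken over vertex sets. *)
Definition strong_component (C : {set V}) : bool :=
  maxset strongly_connected C.

End MixedGraph.

Definition intersecting_supermodular (V : finType) (h : {set V} -> int) : Prop :=
  forall X Y : {set V}, X :&: Y != set0 ->
    (h X + h Y <= h (X :&: Y) + h (X :|: Y))%R.

(* Main.v *)
Require Import Defs.
From mathcomp Require Import all_boot all_order all_algebra zify.
From Stdlib Require Import Classical.

Set Implicit Arguments.
Unset Strict Implicit.
Unset Printing Implicit Defensive.

Import Order.TTheory GRing.Theory Num.Theory.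
Local Open Scope ring_scope.

(* Necessity: an oriented arc entering a member Z of the family has its head in
   Z :&: C, since nothing enters Z :\: C, hence enters no other member.

   Sufficiency: both ends of an edge lie in one strong component C, so the
   components may be oriented independently.  Within C, choosing an orientation
   means choosing a head for each edge, and the requirement on the admissible
   sets Z becomes a lower bound on the number of heads in the traces Z :&: C by
   an intersecting supermodular function.  Its maximum over partitions is fully
   supermodular, and a Hall-type theorem for supermodular demands provides the
   heads.  An arbitrary set X is then reduced to admissible sets by uncrossing
   it with sets Pset C, which no element enters. *)

(** * Counting with sums of indicators *)

Lemma card_set_sum (T : finType) (p : pred T) :
  #|[set x | p x]| = (\sum_x (p x : nat))%N.
Proof.
rewrite -sum1_card big_mkcond /=.
by apply: eq_bigr => x _; rewrite inE; case: (p x).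
Qed.

Lemma Posz_sum (T : finType) (P : pred T) (f : T -> nat) :
  (\sum_(x | P x) f x)%N%:Z = \sum_(x | P x) (f x)%:Z.
Proof. exact: (big_morph Posz PoszD (erefl _)). Qed.

Lemma sum_pred_le_exists (T : finType) (P : {set T}) (b : pred T) :
  (forall x y, x \in P -> y \in P -> b x -> b y -> x = y) ->
  (\sum_(x in P) (b x : nat) <= [exists x in P, b x])%N.
Proof.
move=> uniqb; case: existsP => [[x /andP[xP bx]]|nob] /=.
  rewrite (bigD1 x) //= bx big1 // => y /andP[yP yx].
  by case by_: (b y) => //; rewrite (uniqb y x) ?eqxx in yx.
rewrite big1 // => x xP; case bx: (b x) => //.
by case: nob; exists x; rewrite xP.
Qed.

Lemma exists_le_sum_pred (T : finType) (P : {set T}) (b : pred T) :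
  ([exists x in P, b x] <= \sum_(x in P) (b x : nat))%N.
Proof.
case: existsP => [[x /andP[xP bx]]|//] /=.
by rewrite (bigD1 x) //= bx.
Qed.

(** * Partition closure: from intersecting to full supermodularity *)

Section PartitionClosure.

Variables (V : finType) (R : {set V} -> int -> Prop).

(* Relations [R X k], read "k is an admissible value of X", stand for set
   functions that may take the value minus infinity. *)
Inductive part_val : {set V} -> int -> Prop :=
| PartNil : part_val set0 0
| PartCons Z W k c : R Z k -> Z :&: W = set0 -> part_val W c ->
    part_val (Z :|: W) (k + c).

Lemma part_val1 Z k : R Z k -> part_val Z k.
Proof.
by move=> RZ; rewrite -[Z]setU0 -[k]addr0; apply: PartCons (setI0 _) PartNil.
Qed.

Lemma part_valU X Y a b : X :&: Y = set0 ->
  part_val X a -> part_val Y b -> part_val (X :|: Y) (a + b).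
Proof.
move=> + pX pY; elim: pX => [|Z W k c RZ ZW _ IH] XY; first by rewrite set0U add0r.
rewrite -setUA -addrA; apply: PartCons => //.
  rewrite setIUr ZW set0U; apply/setP => x; move/setP/(_ x): XY; rewrite !inE.
  by do !case: (x \in _).
apply: IH; apply/setP => x; move/setP/(_ x): XY; rewrite !inE.
by do !case: (x \in _).
Qed.

Hypothesis R_super : forall X Y a b, R X a -> R Y b -> X :&: Y != set0 ->
  exists a' b', [/\ R (X :&: Y) a', R (X :|: Y) b' & a + b <= a' + b'].

(* Absorb into Z, one after the other, the blocks of Y that it meets: as these
   are disjoint, the intersections split off are the traces of Z itself. *)
Lemma part_val_uncross1 Z Y k b : R Z k -> part_val Y b ->
  exists a' b', [/\ part_val (Z :&: Y) a', part_val (Z :|: Y) b' & k + b <= a' + b'].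
Proof.
move=> RZ pY; elim: pY Z k RZ => [|Q W q c RQ QW _ IH] Z k RZ.
  exists 0, k; rewrite setI0 setU0; split; [exact: PartNil|exact: part_val1|lia].
have [ZQ|ZQ] := eqVneq (Z :&: Q) set0.
  have [a' [b' [pI pU le]]] := IH _ _ RZ; exists a', (q + b'); split; last by lia.
    by rewrite setIUr ZQ set0U.
  by rewrite setUCA; apply: PartCons => //; rewrite setIUr QW setU0 setIC.
have [al [be [RI RU le1]]] := R_super RZ RQ ZQ.
have [a' [b' [pI pU le2]]] := IH _ _ RU.
exists (al + a'), b'; split; [|by rewrite setUA|lia].
rewrite setIUr; have -> : Z :&: W = (Z :|: Q) :&: W by rewrite setIUl QW setU0.
apply: PartCons => //; apply/setP => x; move/setP/(_ x): QW; rewrite !inE.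
by do !case: (x \in _).
Qed.

(** The blocks [Z] of [X] are uncrossed one by one with the union built so far. Since [Z] misses the
    earlier blocks [W], it meets [W :|: Y] only in [Z :&: Y], so the intersections split off are
    disjoint and together partition [X :&: Y]. *)
Lemma part_val_super X Y a b : part_val X a -> part_val Y b ->
  exists a' b', [/\ part_val (X :&: Y) a', part_val (X :|: Y) b' & a + b <= a' + b'].
Proof.
move=> pX pY; elim: pX => [|Z W k c RZ ZW _ [a1 [b1 [pI1 pU1 le1]]]].
  exists 0, b; rewrite set0I set0U; split=> //; exact: PartNil.
have [a2 [b2 [pI2 pU2 le2]]] := part_val_uncross1 RZ pU1.
exists (a2 + a1), b2; split; [|by rewrite -setUA|lia].
rewrite setIUl; have <- : Z :&: (W :|: Y) = Z :&: Y by rewrite setIUr ZW set0U.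
apply: part_valU => //; apply/setP => x; move/setP/(_ x): ZW; rewrite !inE.
by do !case: (x \in _).
Qed.

End PartitionClosure.

(** * Choosing heads: a Hall-type theorem *)

Definition touching (V E : finType) (N : E -> {set V}) (W : {set V}) : nat :=
  (\sum_e (N e :&: W != set0 : nat))%N.

(* If neither of two elements u, v can be dropped from N e0, the two violated
   inequalities uncross to a violation of the hypothesis, since e0 then misses
   the intersection of the two violating sets. *)
Theorem supermodular_hall (V E : finType) (Q : {set V} -> int -> Prop)
    (N : E -> {set V}) :
  (forall X Y a b, Q X a -> Q Y b ->
     exists a' b', [/\ Q (X :&: Y) a', Q (X :|: Y) b' & a + b <= a' + b']) ->
  (forall e, N e != set0) ->
  (forall W c, Q W c -> c <= (touching N W)%:Z) ->
  exists phi : E -> V, (forall e, phi e \in N e) /\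
    forall W c, Q W c -> c <= (\sum_e (phi e \in W : nat))%N%:Z.
Proof.
move=> Q_super.
have [n] := ubnP (\sum_e #|N e|)%N; elim: n => // n IH in N *.
move=> ltn N0 tQ.
have [/forallP N1|/forallPn[e0 N2]] := boolP [forall e, #|N e| == 1%N].
  (* All lists are singletons: the choice is forced, and touching [W] means being chosen in [W]. *)
  have [phi phiP] := fin_all_exists (fun e => elimT cards1P (N1 e)).
  exists phi; split=> [e|W c /tQ]; first by rewrite phiP set11.
  congr (_ <= _%:Z); apply: eq_bigr => e _; rewrite phiP; congr nat_of_bool.
  apply/set0Pn/idP => [[x]|We]; last by exists (phi e); rewrite !inE eqxx.
  by rewrite !inE => /andP[/eqP->].
have [u [v [uN vN uv]]] : exists u v, [/\ u \in N e0, v \in N e0 & u != v].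
  have /set0Pn[u uN] := N0 e0; exists u.
  have : N e0 :\ u != set0.
    by apply: contraNneq N2 => E0; rewrite (cardsD1 u) uN E0 cards0.
  by move=> /set0Pn[v]; rewrite !inE => /andP[vu vN]; exists v; rewrite eq_sym.
pose drop w e := if e == e0 then N e0 :\ w else N e.
have [ok|bad] := classic (exists w, [/\ w \in N e0, drop w e0 != set0 &
    forall W c, Q W c -> c <= (touching (drop w) W)%:Z]).
  case: ok => w [wN w0 tw].
  have [||//|phi [phiN phiQ]] := IH (drop w).
  - rewrite -ltnS; apply: leq_trans ltn; rewrite ltnS (bigD1 e0) //= [X in (_ < X)%N](bigD1 e0) //=.
    rewrite {1}/drop eqxx (cardsD1 w (N e0)) wN add1n addSn ltnS leq_add2l.
    by apply: leq_sum => e /negPf ne; rewrite /drop ne.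
  - by move=> e; rewrite {1}/drop; case: ifP => // _; move: w0; rewrite /drop eqxx.
  exists phi; split=> // e; have := phiN e; rewrite /drop.
  by case: eqP => // ->; rewrite inE => /andP[].
have viol w : w \in N e0 -> drop w e0 != set0 ->
    exists W c, Q W c /\ (touching (drop w) W)%:Z < c.
  move=> wN w0; apply: NNPP => nex; apply: bad; exists w; split=> // W c QW.
  by rewrite leNgt; apply/negP => lt; apply: nex; exists W, c.
have [|W1 [c1 [Q1 lt1]]] := viol u uN.
  by apply/set0Pn; exists v; rewrite /drop eqxx !inE eq_sym uv.
have [|W2 [c2 [Q2 lt2]]] := viol v vN.
  by apply/set0Pn; exists u; rewrite /drop eqxx !inE uv.
have [a [b [QI QU le]]] := Q_super _ _ _ _ Q1 Q2.
(* The slack 1 comes from [e0] alone, while two strict violations between integers leave a gap of at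
   least 2. *)
have : (touching N (W1 :&: W2) + touching N (W1 :|: W2)
        <= touching (drop u) W1 + touching (drop v) W2 + 1)%N.
  have -> : 1%N = (\sum_e (e == e0 : nat))%N.
    by rewrite (bigD1 e0) //= eqxx big1 // => e /negPf->.
  rewrite /touching -!big_split /=; apply: leq_sum => e _; rewrite /drop.
  case: (eqVneq e e0) => [->|_] /=.
    have [E1|_] := eqVneq ((N e0 :\ u) :&: W1) set0; last by do 3!case: (_ != set0).
    have [E2|_] := eqVneq ((N e0 :\ v) :&: W2) set0; last by do 2!case: (_ != set0).
    (* Here [N e0] can meet [W1] only in [u] and [W2] only in [v], and [u != v]. *)
    have -> : N e0 :&: (W1 :&: W2) = set0.
      apply/setP => x; move/setP/(_ x): E1; move/setP/(_ x): E2; rewrite !inE.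
      case: (x \in N e0) => //=; case: (eqVneq x u) => [->|_] /=.
        by rewrite uv /= => ->; rewrite andbF.
      by move=> _ ->.
    by rewrite eqxx; case: (_ != set0).
  rewrite addn0; set A := N e.
  have [E1|_] := eqVneq (A :&: W1) set0; have [E2|_] := eqVneq (A :&: W2) set0 => /=.
  - by rewrite setIUr E1 E2 setU0 setIA E1 set0I eqxx.
  - by rewrite setIA E1 set0I eqxx; case: (_ != set0).
  - by rewrite setICA E2 setI0 eqxx; case: (_ != set0).
  - by do 2!case: (_ != set0).
have := tQ _ _ QI; have := tQ _ _ QU; lia.
Qed.

(** * Indegrees, reachability and strong components *)

Lemma indeg_submodular (V B : finType) (b : B -> V * V) (X Y : {set V}) :
  (indeg b (X :&: Y) + indeg b (X :|: Y) <= indeg b X + indeg b Y)%N.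
Proof.
rewrite /indeg !card_set_sum -!big_split /=; apply: leq_sum => x _.
rewrite /arc_enters !inE.
by do !case: (_ \in _).
Qed.

Section Reachability.

Variables (V : finType) (F : mixed_graph V).

Definition pred_closed (X : {set V}) : Prop :=
  forall u v, mstep F u v -> v \in X -> u \in X.

Lemma mstep_ends (e : edge F) : mstep F (ends e).1 (ends e).2.
Proof. by apply/orP; left; apply/existsP; exists e; rewrite -surjective_pairing eqxx. Qed.

Lemma mstep_ends_rev (e : edge F) : mstep F (ends e).2 (ends e).1.
Proof.
by apply/orP; left; apply/existsP; exists e; rewrite -surjective_pairing eqxx orbT.
Qed.

Lemma mstep_dir (a : Defs.arc F) : mstep F (dir a).1 (dir a).2.
Proof. by apply/orP; right; apply/existsP; exists a; rewrite -surjective_pairing. Qed.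

(** An edge can be traversed both ways, so closure under predecessors puts its two ends on the same
    side of [X]; for an arc, closure forbids exactly the entering direction. *)
Lemma e_set0P (X : {set V}) : e_set F X = 0%N <-> pred_closed X.
Proof.
rewrite /e_set /e_fam; split=> [/eqP|clX].
  rewrite cards_eq0 => /eqP E0 u v uv vX.
  have noent (x : edge F + Defs.arc F) : ~~ enters x X.
    move/setP/(_ x): E0; rewrite !inE => /negbT; apply: contra => ex.
    by apply/existsP; exists X; rewrite set11.
  case/orP: uv => [/existsP[e]|/existsP[a /eqP da]].
    by have := noent (inl e) => /= + /orP[]/eqP E; rewrite E /= vX; case: (u \in X).
  by have := noent (inr a); rewrite /= /arc_enters da /= vX andbT negbK.
apply/eqP; rewrite cards_eq0; apply/eqP/setP => x; rewrite !inE.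
apply/existsP => -[Y /andP[/set1P-> ]]; case: x => [e|a] /=.
  have := clX _ _ (mstep_ends e); have := clX _ _ (mstep_ends_rev e).
  by move=> c21 c12; have -> : ((ends e).1 \in X) = ((ends e).2 \in X); rewrite ?addbb //; apply/idP/idP.
by rewrite /arc_enters => /andP[/negP nt /(clX _ _ (mstep_dir a))].
Qed.

Definition scc (v : V) : {set V} := [set u | mreach F u v && mreach F v u].

Lemma mreach_refl v : mreach F v v. Proof. exact: connect0. Qed.
Hint Resolve mreach_refl : core.

Lemma mreach_trans v u w : mreach F u v -> mreach F v w -> mreach F u w.
Proof. exact: connect_trans. Qed.

Lemma scc_refl v : v \in scc v.
Proof. by rewrite inE mreach_refl. Qed.

Lemma scc_eq u v : u \in scc v -> scc u = scc v.
Proof.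
rewrite inE => /andP[uv vu]; apply/setP => w; rewrite !inE.
apply/andP/andP => -[w1 w2]; split.
- exact: mreach_trans w1 uv.
- exact: mreach_trans vu w2.
- exact: mreach_trans w1 vu.
- exact: mreach_trans uv w2.
Qed.

Lemma scc_edge (e : edge F) : scc (ends e).1 = scc (ends e).2.
Proof.
apply: scc_eq; rewrite inE /mreach !connect1 //.
  exact: mstep_ends_rev.
exact: mstep_ends.
Qed.

Lemma strongly_connected_mreach C s t :
  strongly_connected F C -> s \in C -> t \in C -> mreach F s t.
Proof.
move=> /andP[_ /forallP/(_ s)/implyP sC] /sC/forallP/(_ t)/implyP tC /tC.
by apply: connect_sub => x y /and3P[_ _ xy]; apply: connect1.
Qed.

(** A walk between two vertices of the class never leaves it: each vertex on the walk is reachable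
    from [v] and reaches [v]. Hence reachability in [F] gives connectivity in the induced
    subgraph. *)
Lemma strongly_connected_scc v : strongly_connected F (scc v).
Proof.
apply/andP; split; first by apply/set0Pn; exists v; apply: scc_refl.
apply/forallP => s; apply/implyP => sC; apply/forallP => t; apply/implyP => tC.
have : mreach F s t.
  by move: sC tC; rewrite !inE => /andP[sv _] /andP[_ vt]; apply: mreach_trans vt.
case/connectP => p; elim: p s sC => [|x p IH] s sC /=; first by move=> _ ->; apply: connect0.
case/andP => sx xp tE; have xC : x \in scc v.
  move: sC tC; rewrite !inE => /andP[_ vs] /andP[tv _]; apply/andP; split.
    by apply: mreach_trans tv; apply/connectP; exists p.
  exact: mreach_trans vs (connect1 sx).
by apply: connect_trans (IH x xC xp tE); apply: connect1; rewrite /= sC xC.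
Qed.

Lemma strong_component_scc v : strong_component F (scc v).
Proof.
apply/maxsetP; split=> [|D scD sub]; first exact: strongly_connected_scc.
have vD : v \in D by apply: (subsetP sub); apply: scc_refl.
apply/eqP; rewrite eqEsubset sub andbT; apply/subsetP => u uD.
by rewrite inE !(strongly_connected_mreach scD).
Qed.

Lemma strong_component_eq C v : strong_component F C -> v \in C -> C = scc v.
Proof.
case/maxsetP => scC maxC vC; apply/esym/maxC; first exact: strongly_connected_scc.
by apply/subsetP => u uC; rewrite inE !(strongly_connected_mreach scC).
Qed.

Lemma Pset_pred_closed X : pred_closed (Pset F X).
Proof.
move=> u v uv; rewrite !inE => /existsP[x /andP[xX vx]].
by apply/existsP; exists x; rewrite xX; apply: mreach_trans vx; apply: connect1.
Qed.

Lemma sub_Pset (X : {set V}) : X \subset Pset F X.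
Proof. by apply/subsetP => x xX; rewrite inE; apply/existsP; exists x; rewrite xX /=. Qed.

Lemma pred_closed_mreach (X : {set V}) u v : pred_closed X -> mreach F u v -> v \in X -> u \in X.
Proof.
move=> clX /connectP[p]; elim: p u => [|x p IH] u /=; first by move=> _ ->.
by case/andP => ux xp vE vX; apply: clX ux _; apply: IH.
Qed.

Lemma Pset_min (X Y : {set V}) : X \subset Y -> pred_closed Y -> Pset F X \subset Y.
Proof.
move=> sXY clY; apply/subsetP => v; rewrite inE => /existsP[x /andP[xX vx]].
by apply: pred_closed_mreach vx _ => //; apply: (subsetP sXY).
Qed.

Lemma in_Pset_scc u v : (u \in Pset F (scc v)) = mreach F u v.
Proof.
rewrite inE; apply/existsP/idP => [[x /andP[]]|uv]; last first.
  by exists v; rewrite scc_refl.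
by rewrite inE => /andP[xv _] ux; apply: mreach_trans xv.
Qed.

(** Lets [h (Pset F C)] replace [h (Pset F Z)] for every admissible [Z]: one vertex of [C] in [Z]
    already brings in everything upstream of [C]. *)
Lemma Pset_sub_scc (Z : {set V}) v : v \in Z -> Z \subset Pset F (scc v) ->
  Pset F Z = Pset F (scc v).
Proof.
move=> vZ sZ; apply/eqP; rewrite eqEsubset; apply/andP; split.
  by apply: Pset_min => //; apply: Pset_pred_closed.
apply/subsetP => u; rewrite in_Pset_scc => uv.
by rewrite inE; apply/existsP; exists v; rewrite vZ.
Qed.

Lemma mstep_oriented (o : edge F -> V * V) x : is_orientation o ->
  mstep F (oriented o x).1 (oriented o x).2.
Proof.
move=> oP; case: x => [e|a] /=; last exact: mstep_dir.
by case: (oP e) => ->; [apply: mstep_ends|apply: mstep_ends_rev].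
Qed.

Lemma enters_oriented (o : edge F -> V * V) x Z : is_orientation o ->
  arc_enters (oriented o x) Z -> enters x Z.
Proof.
move=> oP; case: x => [e|a] //=; rewrite /arc_enters.
by case: (oP e) => -> /=; do 2!case: (_ \in Z).
Qed.

Lemma indeg_pred_closed (o : edge F -> V * V) X : is_orientation o ->
  pred_closed X -> indeg (oriented o) X = 0%N.
Proof.
move=> oP clX; apply/eqP; rewrite cards_eq0; apply/eqP/setP => x; rewrite !inE.
apply/negP => /andP[/negP nt hd]; apply: nt; apply: clX hd.
exact: mstep_oriented.
Qed.

Definition good (C Z : {set V}) : Prop :=
  [/\ Z \subset Pset F C, Z :&: C != set0 & pred_closed (Z :\: C)].

(** Removing [C] commutes with union and intersection, and both preserve closure under predecessors.
    The sets must meet inside [C] for the intersection to keep a nonempty trace. *)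
Lemma good_uncross C Z Z' : good C Z -> good C Z' -> (Z :&: C) :&: (Z' :&: C) != set0 ->
  good C (Z :&: Z') /\ good C (Z :|: Z').
Proof.
move=> [sZ mZ cZ] [sZ' mZ' cZ'] /set0Pn[x]; rewrite !inE => /andP[/andP[xZ xC] /andP[xZ' _]].
split; split.
- by apply: subset_trans sZ; apply: subsetIl.
- by apply/set0Pn; exists x; rewrite !inE xZ xZ'.
- move=> u v uv; move: (cZ _ _ uv) (cZ' _ _ uv); rewrite !inE.
  by do !case: (_ \in _) => //=; auto.
- by rewrite subUset sZ.
- by apply/set0Pn; exists x; rewrite !inE xZ.
- move=> u v uv; move: (cZ _ _ uv) (cZ' _ _ uv); rewrite !inE.
  by do !case: (_ \in _) => //=; auto.
Qed.

Lemma good_scc_mem C Z : strong_component F C -> good C Z ->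
  exists v, [/\ v \in Z, v \in C & C = scc v].
Proof.
move=> Cc [_ /set0Pn[v]]; rewrite inE => /andP[vZ vC] _.
by exists v; split=> //; apply: strong_component_eq.
Qed.

End Reachability.

(** * Necessity: from an orientation to the bound on families *)

Section Orientation.

Variables (V : finType) (F : mixed_graph V) (h : {set V} -> int).
Hypothesis h_super : intersecting_supermodular h.

Lemma family_of_orientation (o : edge F -> V * V) (C : {set V}) (P : {set {set V}}) :
  is_orientation o ->
  (forall X : {set V}, h X - h (Pset F X) <= (indeg (oriented o) X)%:Z) ->
  strong_component F C -> (forall Z, Z \in P -> good F C Z) ->
  (forall Z Z', Z \in P -> Z' \in P -> Z <> Z' -> Z :&: Z' :&: C = set0) ->
  \sum_(Z in P) (h Z - h (Pset F C)) <= (e_fam F P)%:Z.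
Proof.
move=> oP oh Cc gP dP.
apply: (@le_trans _ _ (\sum_(Z in P) indeg (oriented o) Z)%N%:Z).
  rewrite Posz_sum; apply: ler_sum => Z ZP.
  have [v [vZ _ Cv]] := good_scc_mem Cc (gP Z ZP).
  have [sZ _ _] := gP Z ZP; rewrite Cv in sZ *.
  by rewrite -(Pset_sub_scc vZ sZ).
rewrite lez_nat /e_fam card_set_sum.
under eq_bigr do rewrite /indeg card_set_sum.
rewrite exchange_big /=; apply: leq_sum => x _.
have headC Z : Z \in P -> arc_enters (oriented o x) Z -> (oriented o x).2 \in Z :&: C.
  move=> ZP /andP[tZ hZ]; rewrite inE hZ /=; apply: contraNT tZ => hC.
  have [_ _ clZ] := gP Z ZP.
  have := clZ _ _ (mstep_oriented x oP); rewrite !inE hC hZ => /(_ isT).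
  by case/andP.
apply: leq_trans (sum_pred_le_exists _) _ => [Z Z' ZP Z'P eZ eZ'|].
  apply/eqP/negP => /negP/eqP ZZ'.
  have := dP _ _ ZP Z'P ZZ' => /setP/(_ (oriented o x).2).
  have := headC _ ZP eZ; have := headC _ Z'P eZ'.
  by rewrite !inE => /andP[-> ->] /andP[-> _].
case: existsP => [[Z /andP[ZP eZ]]|//]; case: existsP => // -[].
by exists Z; rewrite ZP (enters_oriented oP).
Qed.

(** * Demands on the heads inside one component *)

Definition induced (Y : {set V}) : nat :=
  (\sum_(e : edge F) (((ends e).1 \in Y) && ((ends e).2 \in Y) : nat))%N.

Lemma induced_supermodular X Y :
  (induced X + induced Y <= induced (X :&: Y) + induced (X :|: Y))%N.
Proof.
rewrite /induced -!big_split /=; apply: leq_sum => e _; rewrite !inE.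
by do !case: (_ \in _).
Qed.

(* Every edge induced by [Z :&: C] has its head there without entering [Z],
   whence the last term. *)
Definition demand (C Z : {set V}) : int :=
  h Z - h (Pset F C) - (indeg (@dir V F) Z)%:Z + (induced (Z :&: C))%:Z.

(** A relation rather than a function: admissible sets that differ only outside [C] share a trace
    but may have different demands. *)
Definition trace_val (C Y : {set V}) (k : int) : Prop :=
  exists Z, [/\ good F C Z, Y = Z :&: C & k = demand C Z].

Lemma trace_val_super C X Y a b :
  trace_val C X a -> trace_val C Y b -> X :&: Y != set0 ->
  exists a' b', [/\ trace_val C (X :&: Y) a', trace_val C (X :|: Y) b' & a + b <= a' + b'].
Proof.
move=> [Z [gZ -> ->]] [Z' [gZ' -> ->]] meet.
have [gI gU] := good_uncross gZ gZ' meet.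
have EI : (Z :&: C) :&: (Z' :&: C) = (Z :&: Z') :&: C.
  by rewrite setIACA setIid.
have EU : (Z :&: C) :|: (Z' :&: C) = (Z :|: Z') :&: C by rewrite setIUl.
exists (demand C (Z :&: Z')), (demand C (Z :|: Z')); split.
- by exists (Z :&: Z').
- by exists (Z :|: Z').
have ZZ' : Z :&: Z' != set0.
  by apply: contraNneq meet; rewrite EI => ->; rewrite set0I.
have := h_super ZZ'; have := induced_supermodular (Z :&: C) (Z' :&: C).
have := indeg_submodular (@dir V F) Z Z'.
by rewrite EI EU /demand; lia.
Qed.

Lemma part_val_family C W c : part_val (trace_val C) W c ->
  exists P : {set {set V}},
    [/\ forall Z, Z \in P -> good F C Z,
        forall Z Z', Z \in P -> Z' \in P -> Z <> Z' -> Z :&: Z' :&: C = set0,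
        forall x, (x \in W) = [exists Z in P, x \in Z :&: C] &
        c = \sum_(Z in P) demand C Z].
Proof.
elim=> [|_ {}W _ {}c [Z [gZ -> ->]] ZW _ [P [gP dP WP ->]]].
  exists set0; split=> [Z|Z Z'|x|]; rewrite ?big_set0 ?inE //.
  by apply/esym/existsP => -[Z]; rewrite inE.
have ZP Z' : Z' \in P -> Z :&: Z' :&: C = set0.
  move=> Z'P; apply/setP => x; move/setP/(_ x): ZW; rewrite !inE WP => /negbT.
  rewrite negb_and => H; apply/negP => /andP[/andP[xZ xZ'] xC]; move: H.
  by rewrite xZ xC /= => /existsP[]; exists Z'; rewrite Z'P inE xZ' xC.
(* Otherwise [Z] would have an empty trace; so no member repeats, and a set [P] records the blocks
   faithfully. *)
have nZP : Z \notin P.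
  by apply/negP => /ZP; rewrite setIid; case: gZ => _ /eqP.
exists (Z |: P); split.
- by move=> Z' /setU1P[->|/gP].
- move=> Z1 Z2 /setU1P[->|P1] /setU1P[->|P2] // ne; first exact: ZP.
    by rewrite [Z1 :&: Z]setIC; apply: ZP.
  exact: dP.
- move=> x; rewrite in_setU WP; apply/orP/existsP.
    case=> [xZ|/existsP[Z' /andP[Z'P xZ']]]; first by exists Z; rewrite setU11.
    by exists Z'; rewrite setU1r.
  case=> Z' /andP[/setU1P[->|Z'P] xZ']; first by left.
  by right; apply/existsP; exists Z'; rewrite Z'P.
- by rewrite big_setU1.
Qed.

Definition ends_set (e : edge F) : {set V} := [set (ends e).1; (ends e).2].

(** This turns the bound on families into the Hall condition for [demand]. The count is per element.
    An edge is induced by at most one trace, as traces are disjoint. If it enters [Z], its end in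
    [Z] lies in [C], because [Z :\: C] is closed under predecessors; then no other trace contains
    both ends. So each edge contributes at most 1 on the left, and only when it touches [W]. *)
Lemma family_entering (C W : {set V}) (P : {set {set V}}) :
  (forall Z, Z \in P -> good F C Z) ->
  (forall Z Z', Z \in P -> Z' \in P -> Z <> Z' -> Z :&: Z' :&: C = set0) ->
  (forall x, (x \in W) = [exists Z in P, x \in Z :&: C]) ->
  (e_fam F P + \sum_(Z in P) induced (Z :&: C)
     <= touching ends_set W + \sum_(Z in P) indeg (@dir V F) Z)%N.
Proof.
move=> gP dP WP.
have uniqP x Z Z' : Z \in P -> Z' \in P -> x \in Z :&: C -> x \in Z' -> Z = Z'.
  move=> ZP Z'P; rewrite inE => /andP[xZ xC] xZ'; apply/eqP/negP => /negP/eqP ne.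
  by have /setP/(_ x) := dP _ _ ZP Z'P ne; rewrite !inE xZ xC xZ'.
rewrite /e_fam card_set_sum big_sumType /= -addnA [X in (_ + X)%N]addnC addnA.
apply: leq_add; last first.
  under [X in (_ <= X)%N]eq_bigr do rewrite /indeg card_set_sum.
  rewrite exchange_big /=; apply: leq_sum => a _; exact: exists_le_sum_pred.
rewrite /induced exchange_big -big_split /=; apply: leq_sum => e _.
set u := (ends e).1; set v := (ends e).2.
have touch x : x \in ends_set e -> x \in W -> ends_set e :&: W != set0.
  by move=> xe xW; apply/set0Pn; exists x; rewrite inE xe.
have ue : u \in ends_set e by rewrite !inE eqxx.
have ve : v \in ends_set e by rewrite !inE eqxx orbT.
have inW Z x : Z \in P -> x \in Z :&: C -> x \in W.
  by move=> ZP xZ; rewrite WP; apply/existsP; exists Z; rewrite ZP.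
have sum_le : (\sum_(Z in P) ((u \in Z :&: C) && (v \in Z :&: C) : nat)
    <= [exists Z in P, (u \in Z :&: C) && (v \in Z :&: C)])%N.
  apply: sum_pred_le_exists => Z Z' ZP Z'P /andP[uZ _] /andP[uZ' _].
  by apply: uniqP uZ _ => //; case/setIP: uZ'.
apply: leq_trans (leq_add (leqnn _) sum_le) _.
have [/existsP[Z /andP[ZP]]|_] := boolP [exists Y in P, (u \in Y) (+) (v \in Y)]; last first.
  rewrite add0n; case: existsP => [[Z /and3P[ZP uZ _]]|//].
  by rewrite (touch u) // (inW Z).
move=> eZ.
have [x [y [xe xZC yZ xy]]] : exists x y, [/\ x \in ends_set e, x \in Z :&: C,
    y \notin Z & (x, y) = (u, v) \/ (x, y) = (v, u)].
  have [_ _ clZ] := gP _ ZP.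
  have := clZ _ _ (mstep_ends e); have := clZ _ _ (mstep_ends_rev e).
  rewrite -/u -/v !inE.
  move: eZ; case uZ: (u \in Z); case vZ: (v \in Z) => //= _.
    rewrite !andbF !andbT /= => cl _; exists u, v; rewrite ue inE uZ vZ; split=> //.
      by apply/negPn/negP => /cl.
    by left.
  rewrite !andbF !andbT /= => _ cl; exists v, u; rewrite ve inE uZ vZ; split=> //.
    by apply/negPn/negP => /cl.
  by right.
rewrite (touch x) ?(inW Z) //; case: existsP => //= -[Z' /and3P[Z'P uZ' vZ']].
have [xZ' yZ'] : x \in Z' /\ y \in Z'.
  by case/setIP: uZ' vZ' => uZ' _ /setIP[vZ' _]; case: xy => -[-> ->].
by rewrite (uniqP x Z Z' ZP Z'P xZC xZ') yZ' in yZ.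
Qed.

(** * Sufficiency: building the orientation *)

Section Sufficiency.

Hypothesis family_bound : forall (C : {set V}) (P : {set {set V}}),
  strong_component F C -> (forall Z, Z \in P -> good F C Z) ->
  (forall Z Z', Z \in P -> Z' \in P -> Z <> Z' -> Z :&: Z' :&: C = set0) ->
  \sum_(Z in P) (h Z - h (Pset F C)) <= (e_fam F P)%:Z.

Lemma component_heads C : exists phi : edge F -> V,
  (forall e, phi e \in ends_set e) /\
  (strong_component F C -> forall Z, good F C Z ->
     demand C Z <= (\sum_e (phi e \in Z :&: C : nat))%N%:Z).
Proof.
have [Cc|nC] := boolP (strong_component F C); last first.
  (* An arbitrary choice, so that finite choice can range over all vertex sets [C]. *)
  by exists (fun e => (ends e).1); split=> // e; rewrite !inE eqxx.
have [||W c /part_val_family[P [gP dP WP ->]]|phi [phiN phiQ]] :=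
    @supermodular_hall _ _ (part_val (trace_val C)) ends_set.
- by move=> X Y a b; apply: part_val_super; apply: trace_val_super.
- by move=> e; apply/set0Pn; exists (ends e).1; rewrite !inE eqxx.
- have := family_bound Cc gP dP; have := family_entering gP dP WP.
  have -> : \sum_(Z in P) demand C Z = \sum_(Z in P) (h Z - h (Pset F C))
      - (\sum_(Z in P) indeg (@dir V F) Z)%N%:Z
      + (\sum_(Z in P) induced (Z :&: C))%N%:Z.
    by rewrite !Posz_sum -sumrB -big_split.
  lia.
exists phi; split=> // _ Z gZ; apply: phiQ; apply: part_val1.
by exists Z.
Qed.

Lemma orientation_good : exists o : edge F -> V * V, is_orientation o /\
  forall C Z, strong_component F C -> good F C Z ->
    h Z - h (Pset F C) <= (indeg (oriented o) Z)%:Z.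
Proof.
have [phi phiP] := fin_all_exists component_heads.
(* Each edge follows the choice made for its own component, which contains both its ends. *)
pose head e := phi (scc F (ends e).1) e.
have headE e : head e \in ends_set e by case: (phiP (scc F (ends e).1)) => H _; apply: H.
pose o e := if head e == (ends e).2 then ends e else swap_ends (ends e).
have o2 e : (o e).2 = head e.
  rewrite /o; case: eqP => [->//|/eqP ne] /=.
  by have := headE e; rewrite !inE (negPf ne) orbF => /eqP.
have oP : is_orientation o by move=> e; rewrite /o; case: ifP; [left|right].
exists o; split=> // C Z Cc gZ.
have [_ /(_ Cc Z gZ)] := phiP C.
(* An edge whose head lies in [Z :&: C] either has its tail outside [Z] and enters [Z], or is
   induced by [Z :&: C]. *)
suff le : (\sum_e (phi C e \in Z :&: C : nat) + indeg (@dir V F) Z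
    <= indeg (oriented o) Z + induced (Z :&: C))%N by rewrite /demand; lia.
rewrite /indeg !card_set_sum big_sumType /= addnAC leq_add2r.
rewrite /induced -big_split /=; apply: leq_sum => e _.
have [phiC|//] := boolP (phi C e \in Z :&: C).
have [phiZ phiCC] := setIP phiC.
have Ceq : C = scc F (ends e).1.
  rewrite (strong_component_eq Cc phiCC); have [/(_ e)] := phiP C.
  by rewrite !inE => /orP[]/eqP->; rewrite // scc_edge.
have hd : head e = phi C e by rewrite /head -Ceq.
have e1C : (ends e).1 \in C by rewrite Ceq scc_refl.
have e2C : (ends e).2 \in C by rewrite Ceq scc_edge scc_refl.
rewrite !inE e1C e2C !andbT /arc_enters o2 hd phiZ andbT.
have := o2 e; rewrite hd /o.
by case: ifP => _ /= E; rewrite -E in phiZ; rewrite phiZ; case: (_ \in Z).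
Qed.

End Sufficiency.

(* Uncrossing [X] with the upstream set of a most upstream component C that
   witnesses [X <> Pset F X] leaves a good set for C and a set larger than X. *)
Lemma orientation_all (o : edge F -> V * V) : is_orientation o ->
  (forall C Z, strong_component F C -> good F C Z ->
    h Z - h (Pset F C) <= (indeg (oriented o) Z)%:Z) ->
  forall X : {set V}, h X - h (Pset F X) <= (indeg (oriented o) X)%:Z.
Proof.
move=> oP og X; have [n] := ubnP #|~: X|; elim: n => // n IH in X *; move=> ltn.
pose bad v := (v \in X) && ~~ (Pset F (scc F v) \subset X).
have [v0 bad0|nobad] := pickP bad; last first.
  (* With no bad vertex, [X] contains everything upstream of it, and the claimed lower bound is
     0. *)
  suff -> : Pset F X = X by rewrite subrr.
  apply/eqP; rewrite eqEsubset sub_Pset andbT; apply/subsetP => w.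
  rewrite inE => /existsP[v /andP[vX wv]].
  have := nobad v; rewrite /bad vX => /negbFE/subsetP; apply.
  by rewrite in_Pset_scc.
case: (arg_minnP (fun v => #|Pset F (scc F v)|) bad0) => v /andP[vX nsub] minv.
set C := scc F v in nsub; set Q := Pset F C in nsub.
have clQ : pred_closed F Q := @Pset_pred_closed _ _ _.
have vC : v \in C := scc_refl _ _.
have vQ : v \in Q by apply: (subsetP (sub_Pset _ _)).
have gZ : good F C (X :&: Q).
  split; first exact: subsetIr.
    by apply/set0Pn; exists v; rewrite 2!in_setI vX vQ.
  move=> w y wy /setDP[/setIP[yX yQ] yC].
  have yv : mreach F y v by rewrite -in_Pset_scc.
  have nvy : ~~ mreach F v y by apply: contra yC => vy; rewrite inE yv.
  have wQ : w \in Q by apply: clQ wy yQ.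
  have wC : w \notin C.
    apply: contra nvy; rewrite inE => /andP[_ vw].
    exact: mreach_trans vw (connect1 wy).
  (* As [y] reaches [v] but not conversely, the upstream set of [y] is strictly smaller than [Q]. By
     minimality [y] is not bad, so [X] contains all predecessors of [y]. *)
  have wX : w \in X.
    have /subsetP : Pset F (scc F y) \subset X.
      apply: contraT => ny; have := minv y; rewrite /bad yX ny => /(_ isT).
      rewrite leqNgt => /negP[]; apply: proper_card; apply/properP; split.
        apply/subsetP => x; rewrite !in_Pset_scc => xy; exact: mreach_trans yv.
      by exists v; rewrite ?in_Pset_scc // mreach_refl.
    by apply; rewrite in_Pset_scc; apply: connect1.
  by rewrite in_setD wC in_setI wX.
(* [Q] lies upstream of [v], a vertex of [X], so the induction hypothesis for [X :|: Q] bounds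
   against the same [h (Pset F X)]. *)
have PU : Pset F (X :|: Q) = Pset F X.
  apply/eqP; rewrite eqEsubset; apply/andP; split; apply: Pset_min.
  - rewrite subUset sub_Pset; apply/subsetP => w; rewrite in_Pset_scc => wv.
    by rewrite inE; apply/existsP; exists v; rewrite vX.
  - exact: Pset_pred_closed.
  - by apply: subset_trans (subsetUl _ _) (sub_Pset _ _).
  - exact: Pset_pred_closed.
have : (#|~: (X :|: Q)| < n)%N.
  rewrite -ltnS; apply: leq_trans ltn; rewrite ltnS; apply: proper_card; rewrite properC.
  by rewrite properE subsetUl subUset negb_and nsub orbT.
move/IH; rewrite PU.
(* The bounds for [X :&: Q] and [X :|: Q] are added; supermodularity of [h] cancels [h Q], and [Q]
   has indegree 0. *)
have := og _ _ (strong_component_scc F v) gZ; rewrite -/C -/Q.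
have := indeg_submodular (oriented o) X Q; rewrite (indeg_pred_closed oP clQ).
have : X :&: Q != set0 by apply/set0Pn; exists v; rewrite inE vX.
by move/h_super; lia.
Qed.

End Orientation.

Theorem theorem10 (V : finType) (F : mixed_graph V) (h : {set V} -> int)
  (h_super : intersecting_supermodular h) :
  (exists o : edge F -> V * V, is_orientation o /\
     forall X : {set V},
       h X - h (Pset F X) <= (indeg (oriented o) X)%:Z)
  <->
  (forall (C : {set V}) (P : {set {set V}}),
     strong_component F C ->
     (forall Z, Z \in P -> Z \subset Pset F C) ->
     (forall Z, Z \in P -> Z :&: C != set0 /\ e_set F (Z :\: C) = 0%N) ->
     (forall Z Z', Z \in P -> Z' \in P -> Z <> Z' -> Z :&: Z' :&: C = set0) ->
     \sum_(Z in P) (h Z - h (Pset F C)) <= (e_fam F P)%:Z).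
Proof.
split=> [[o [oP oh]] C P Cc sP eP dP|bound].
  apply: (family_of_orientation oP oh Cc _ dP) => Z ZP.
  by have [mZ /e_set0P clZ] := eP Z ZP; split=> //; apply: sP.
have [C P Cc gP dP|o [oP og]] := @orientation_good V F h h_super.
  apply: bound => // Z /gP[sZ mZ clZ] //.
  by split=> //; apply/e_set0P.
by exists o; split=> //; apply: orientation_all.
Qed.
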